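(* Let $H$ be a linear intersecting hypergraph of rank $4$ without isolated vertices. Then $\gamma(H)=3$ if and only if $H$ is isomorphic to one of $F_1$, $F_1^-$, $F_2$, $F_3$.
   Context: A hypergraph $H=(V(H),E(H))$ is a finite set $V(H)$ together with a collection $E(H)$ of subsets of $V(H)$ (edges); hypergraphs have no multiple edges and every edge has at least $2$ vertices. The rank is the maximum edge size. $H$ is intersecting if any two edges intersect, and linear if any two distinct edges share at most one vertex. The degree of a vertex is the number of edges containing it; isolated means degree $0$. Two vertices are adjacent if some edge contains both; $D\subseteq V(H)$ is dominating if every vertex of $V(H)\setminus D$ is adjacent to a vertex of $D$; $\gamma(H)$ is the minimum size of a dominating set. The Fano plane $F$ is the $3$-uniform hypergraph on $7$ vertices whose $7$ edges are the lines of the projective plane of order $2$; $F^-$ is obtained from $F$ by deleting one edge (keeping all $7$ vertices). $F_1$ (resp. $F_1^-$) is obtained from $F$ (resp. $F^-$) by adding to each edge a new vertex, distinct new vertices for distinct edges (so each edge becomes a $4$-edge containing one new vertex of degree $1$). $F_2$ is obtained from $F_1$ by removing from one edge its degree-$1$ vertex (that edge becomes a $3$-edge). $F_3$ is obtained from $F_1^-$ by adding a new edge $f=\{x_1,x_2,x_3,x_4\}$ where $x_1,x_2,x_3,x_4$ lie in distinct edges of $F_1^-$, $x_1,x_2$ have degree $2$ in $F_1^-$, and $x_3,x_4$ have degree $1$ in $F_1^-$. *)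

(* Defs.v *)
From mathcomp Require Import all_boot all_algebra.
Set Implicit Arguments.
Unset Strict Implicit.
Unset Printing Implicit Defensive.

(* A hypergraph with vertex set V is given by its edge set E; the carrier type
   is the whole vertex set, so isolated vertices are possible. *)
Section Hypergraph.
Variable V : finType.
Implicit Types (E : {set {set V}}) (D : {set V}) (u v x : V).

Definition edges_ge2 E : Prop := forall e, e \in E -> 2 <= #|e|.

Definition rank E : nat := \max_(e in E) #|e|.

Definition intersecting E : Prop :=
  forall e f, e \in E -> f \in E -> e :&: f != set0.

Definition linear_hypergraph E : Prop :=
  forall e f, e \in E -> f \in E -> e != f -> #|e :&: f| <= 1.

Definition degree E v : nat := #|[set e in E | v \in e]|.

Definition no_isolated E : Prop := forall v, degree E v != 0.

Definition adjacent E u v : bool := [exists e in E, (u \in e) && (v \in e)].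

Definition dominating E D : bool :=
  [forall v, (v \notin D) ==> [exists u in D, adjacent E u v]].

(* The fallback [set: V] of the arg min is itself dominating, so this is the
   minimum over all dominating sets. *)
Definition domination_number E : nat :=
  #|[arg min_(D < [set: V] | dominating E D) #|D|]|.

(* The new vertex attached to the edge e is inr e. *)
Definition add_pendants E : {set {set (V + {e : {set V} | e \in E})}} :=
  [set inr e |: [set inl v | v in val e] | e : {e : {set V} | e \in E}].

(* Vertex x is removed from the vertex set and from every edge. *)
Definition remove_vertex E x : {set {set {v : V | v != x}}} :=
  [set [set v | val v \in e] | e : {set V} in E].

End Hypergraph.

Definition isomorphic (V W : finType) (E : {set {set V}}) (F : {set {set W}}) :
  Prop :=
  exists2 f : V -> W, bijective f & [set f @: e | e : {set V} in E] = F.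

(* Points are the integers mod 7; lines are the translates of the perfect
   difference set {0, 1, 3}. *)
Definition fano : {set {set 'Z_7}} :=
  [set [set i; (i + 1)%R; (i + 3%:R)%R] | i : 'Z_7].

Lemma card_fano_line (l : {set 'Z_7}) : l \in fano -> #|l| = 3.
Proof.
case/imsetP=> i _ ->; rewrite -setUA cardsU1 cards2 !inE.
by case: i => [[|[|[|[|[|[|[|]]]]]]]].
Qed.

Lemma fano_plane (x y : 'Z_7) :
  x != y -> exists! l, l \in fano /\ (x \in l /\ y \in l).
Proof.
have key : forall x y : 'Z_7, x != y -> exists i : 'Z_7,
    forall j : 'Z_7, (x \in [set j; (j + 1)%R; (j + 3%:R)%R]) &&
      (y \in [set j; (j + 1)%R; (j + 3%:R)%R]) = (j == i).
  move=> a b nab.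
  suff [i hi] : exists i : 'Z_7, forall j : 'Z_7,
      ((a == j) || (a == j + 1)%R || (a == j + 3%:R)%R) &&
      ((b == j) || (b == j + 1)%R || (b == j + 3%:R)%R) = (j == i).
    by exists i => j; rewrite !inE hi.
  move: a b nab.
  case=> [[|[|[|[|[|[|[|//]]]]]]] ha]; case=> [[|[|[|[|[|[|[|//]]]]]]] hb] nab;
  try by [];
  first [ exists (inZp 0); by case=> [[|[|[|[|[|[|[|//]]]]]]] hj]
        | exists (inZp 1); by case=> [[|[|[|[|[|[|[|//]]]]]]] hj]
        | exists (inZp 2); by case=> [[|[|[|[|[|[|[|//]]]]]]] hj]
        | exists (inZp 3); by case=> [[|[|[|[|[|[|[|//]]]]]]] hj]
        | exists (inZp 4); by case=> [[|[|[|[|[|[|[|//]]]]]]] hj]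
        | exists (inZp 5); by case=> [[|[|[|[|[|[|[|//]]]]]]] hj]
        | exists (inZp 6); by case=> [[|[|[|[|[|[|[|//]]]]]]] hj] ].
move=> /key[i hi]; exists [set i; (i + 1)%R; (i + 3%:R)%R]; split.
  split; first exact: imset_f.
  by apply/andP; rewrite hi.
by move=> l' [/imsetP[j _ ->] /andP]; rewrite hi => /eqP ->.
Qed.

Definition fano_minus (l : {set 'Z_7}) : {set {set 'Z_7}} := fano :\ l.

Definition F1 := add_pendants fano.
Definition F1_minus (l : {set 'Z_7}) := add_pendants (fano_minus l).

(* The constructions of F1^-, F2 and F3 involve a choice, which is immaterial
   up to isomorphism; it is left open in the next three predicates. *)
Section IsomorphismTypes.
Variables (V : finType) (E : {set {set V}}).

Definition is_F1 : Prop := isomorphic E F1.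

Definition is_F1_minus : Prop :=
  exists2 l, l \in fano & isomorphic E (F1_minus l).

(* As x has degree 1, removing it changes the edge e only. *)
Definition is_F2 : Prop :=
  exists e x, [/\ e \in F1, x \in e, degree F1 x = 1 &
    isomorphic E (remove_vertex F1 x)].

(* That the x_i lie in distinct edges means that no edge contains two of them:
   otherwise adding f would not give a linear hypergraph. *)
Definition is_F3 : Prop :=
  exists l, l \in fano /\ exists x1 x2 x3 x4,
    let G := F1_minus l in
    let f := [set x1; x2; x3; x4] in
    [/\ uniq [:: x1; x2; x3; x4],
        forall e, e \in G -> #|e :&: f| <= 1,
        degree G x1 = 2 /\ degree G x2 = 2,
        degree G x3 = 1 /\ degree G x4 = 1 &
        isomorphic E (f |: G)].

End IsomorphismTypes.

(* Main.v *)
(** A hypergraph with a fixed enumeration of its edges is determined up to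
    isomorphism by the set of "traces" of its vertices, the trace of a vertex
    being the set of indices of the edges through it, as soon as distinct
    vertices have distinct traces.  The domination number is read off the traces
    as well.

    Suppose that no two vertices dominate.  If w is not adjacent to x and f is
    an edge through w, then the edges through x meet f in distinct vertices
    other than w; hence all degrees are at most 3.  Some x has degree 3, and x
    then has three pairwise nonadjacent non-neighbours w1, w2, w3: no edge
    contains two of them.  The pencils of x, w1, w2, w3 are disjoint, so
    3 + deg w1 + deg w2 + deg w3 <= m, where m is the number of edges, and
    counting the edges that meet an edge through w gives m <= deg w + 6.  Hence
    m is 6 or 7 and, up to order, w1 and w2 have degree 1 and w3 has degree 1 or
    2.  Since two edges share exactly one vertex, the traces of size at least 2
    decompose the complete graph on the m edges into edges and triangles, with
    at most 4 of the traces through each label.  The few decompositions that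
    contain the traces of x, w1, w2, w3 are enumerated by computation. *)

Require Import Defs.
From mathcomp Require Import all_boot all_algebra zify.

Set Implicit Arguments.
Unset Strict Implicit.
Unset Printing Implicit Defensive.

(** * Traces and domination *)

Definition meets (s t : seq nat) := has (mem t) s.

Section Trace.
Variable V : finType.
Implicit Types (E : {set {set V}}) (es : seq {set V}) (u v : V).
Implicit Type T : seq (seq nat).

Definition trace es v := [seq i <- iota 0 (size es) | v \in nth set0 es i].

Definition coded es T := injective (trace es) /\ codom (trace es) =i T.

Lemma mem_trace es v i : (i \in trace es v) = (v \in nth set0 es i).
Proof.
rewrite mem_filter mem_iota /=; case: (ltnP i (size es)) => [|le_i].
  by rewrite andbT.
by rewrite nth_default // inE.
Qed.

Lemma trace_lt es v i : i \in trace es v -> i < size es.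
Proof. by rewrite mem_filter mem_iota => /andP[]. Qed.

Lemma trace_sorted es v : sorted ltn (trace es v).
Proof. by apply: (sorted_filter ltn_trans); exact: iota_ltn_sorted. Qed.

Lemma trace_uniq es v : uniq (trace es v).
Proof. exact/filter_uniq/iota_uniq. Qed.

Lemma traceE es v t :
  sorted ltn t -> (forall i, (i \in t) = (v \in nth set0 es i)) -> trace es v = t.
Proof.
move=> t_sorted tE; apply: (irr_sorted_eq ltn_trans ltnn) => //.
  exact: trace_sorted.
by move=> i; rewrite tE mem_trace.
Qed.

Lemma trace_filter es v (p : pred nat) :
  {in gtn (size es), forall i, p i = (v \in nth set0 es i)} ->
  trace es v = [seq i <- iota 0 (size es) | p i].
Proof.
move=> pE; apply: eq_in_filter => i; rewrite mem_iota /= => lt_i.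
by rewrite pE.
Qed.

Lemma size_trace es v : size (trace es v) = count (fun e : {set V} => v \in e) es.
Proof.
rewrite size_filter -[in RHS](mkseq_nth set0 es) count_map.
by apply: eq_count => i.
Qed.

Lemma trace_cat es fs v :
  trace (es ++ fs) v = trace es v ++ [seq size es + i | i <- trace fs v].
Proof.
rewrite /trace size_cat iotaD filter_cat add0n; congr (cat _ _).
  by apply: eq_in_filter => i; rewrite mem_iota /= nth_cat => ->.
rewrite -{1}[size es]addn0 iotaDl filter_map; congr map.
by apply: eq_filter => i /=; rewrite nth_cat ltnNge leq_addr addKn.
Qed.

Lemma trace_full es v :
  {in es, forall e : {set V}, v \in e} -> trace es v = iota 0 (size es).
Proof.
move=> v_in; apply/all_filterP/allP => i; rewrite mem_iota /= => lt_i.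
exact/v_in/mem_nth.
Qed.

Lemma trace_nil es v : {in es, forall e : {set V}, v \notin e} -> trace es v = [::].
Proof.
move=> v_out; apply/eqP; rewrite -size_eq0 size_trace -leqn0 leqNgt -has_count.
by apply/hasPn=> e /v_out.
Qed.

Lemma degree_trace E es v : uniq es -> E =i es -> degree E v = size (trace es v).
Proof.
move=> es_uniq eqE; rewrite size_trace -size_filter.
rewrite -(card_uniqP (filter_uniq _ es_uniq)); apply: eq_card => e.
by rewrite !inE mem_filter eqE andbC.
Qed.

Lemma adjacent_trace E es u v :
  E =i es -> adjacent E u v = meets (trace es u) (trace es v).
Proof.
move=> eqE; rewrite /meets; apply/exists_inP/hasP=> [[e] | [i]].
  rewrite eqE => /(nthP set0)[i lt_i <-] /andP[u_i v_i].
  by exists i; rewrite /= mem_trace.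
move=> /[dup] /trace_lt lt_i; rewrite /= !mem_trace => u_i v_i.
by exists (nth set0 es i); [rewrite eqE mem_nth | rewrite u_i].
Qed.

End Trace.

Lemma trace_preimset (V W : finType) (f : V -> W) (es : seq {set W}) v :
  trace [seq f @^-1: e | e : {set W} <- es] v = trace es (f v).
Proof.
rewrite /trace size_map; apply: eq_in_filter => i; rewrite mem_iota /= => lt_i.
by rewrite (nth_map set0) // inE.
Qed.

(** Pulling the enumeration of [F] back along the bijection leaves the trace of every vertex
    unchanged. *)
Lemma isomorphic_coded (V W : finType) (E : {set {set V}}) (F : {set {set W}}) fs T :
  F =i fs -> coded fs T -> isomorphic E F ->
  exists es, [/\ E =i es, coded es T & size es = size fs].
Proof.
move=> eqF [fs_inj fsT] [f f_bij imE].
exists [seq f @^-1: e | e : {set W} <- fs]; split; last by rewrite size_map.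
- move=> e; rewrite -(mem_imset _ _ (imset_inj (bij_inj f_bij))) imE eqF.
  have preimK (A : {set W}) : f @: (f @^-1: A) = A.
    apply/setP=> w; have [g fK gK] := f_bij; rewrite -{1}(gK w).
    by rewrite mem_imset ?inE ?gK //; exact: bij_inj.
  apply/idP/mapP=> [fs_e | [A fs_A ->]]; last by rewrite preimK.
  exists (f @: e) => //; apply/setP=> v.
  by rewrite inE mem_imset //; exact: bij_inj.
- split=> [u v | t]; first by rewrite !trace_preimset => /fs_inj/(bij_inj f_bij).
  rewrite -fsT; apply/codomP/codomP=> [[v ->] | [w ->]].
    by exists (f v); rewrite trace_preimset.
  by have [g fK gK] := f_bij; exists (g w); rewrite trace_preimset gK.
Qed.

(** Each vertex is sent to the vertex with the same trace. It exists because the codomains agree and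
    is unique because traces are injective; equal traces mean that the i-th edge is mapped onto the
    i-th edge. *)
Lemma coded_isomorphic (V W : finType) (E : {set {set V}}) (F : {set {set W}}) es fs T :
  E =i es -> coded es T -> F =i fs -> coded fs T -> size es = size fs ->
  isomorphic E F.
Proof.
move=> eqE [es_inj esT] eqF [fs_inj fsT] eq_size.
have ex_f v : exists w, trace fs w == trace es v.
  have: trace es v \in codom (trace fs) by rewrite fsT -esT codom_f.
  by case/codomP=> w ->; exists w.
have ex_g w : exists v, trace es v == trace fs w.
  have: trace fs w \in codom (trace es) by rewrite esT -fsT codom_f.
  by case/codomP=> v ->; exists v.
pose f v := xchoose (ex_f v); pose g w := xchoose (ex_g w).
have fP v : trace fs (f v) = trace es v by exact: eqP (xchooseP (ex_f v)).
have gP w : trace es (g w) = trace fs w by exact: eqP (xchooseP (ex_g w)).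
have fK : cancel f g by move=> v; apply: es_inj; rewrite gP fP.
have gK : cancel g f by move=> w; apply: fs_inj; rewrite fP gP.
exists f; first by exists g.
have im_nth i : f @: nth set0 es i = nth set0 fs i.
  apply/setP=> w; rewrite -(gK w) mem_imset; last exact: can_inj fK.
  by rewrite -!mem_trace fP.
apply/setP=> B; rewrite eqF; apply/imsetP/idP=> [[e] | /(nthP set0)[i lt_i <-]].
  by rewrite eqE => /(nthP set0)[i lt_i <-] ->; rewrite im_nth mem_nth -?eq_size.
by exists (nth set0 es i); rewrite ?im_nth // eqE mem_nth ?eq_size.
Qed.

Definition undominated (T : seq (seq nat)) :=
  all (fun s => all (fun t => has (fun w => ~~ meets s w && ~~ meets t w) T) T) T.

(* In the codes below the pendant traces come last, so for an edge i with a
   pendant vertex the set D consists of the other three vertices of i. *)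
Definition dominated3 (T : seq (seq nat)) :=
  has (fun i => let D := take 3 [seq t <- T | i \in t] in
    all (fun w => has (fun t => meets t w) D) T) (flatten T).

Section Domination.
Variables (V : finType) (E : {set {set V}}) (es : seq {set V}) (T : seq (seq nat)).
Hypothesis eqE : E =i es.

Lemma undominated_codom :
  codom (trace es) =i T ->
  undominated T <-> forall u v, exists w, ~~ adjacent E u w && ~~ adjacent E v w.
Proof.
move=> esT; split=> [undom u v | nadj].
  have tT w : trace es w \in T by rewrite -esT codom_f.
  have /allP/(_ _ (tT v))/hasP[t] := allP undom _ (tT u).
  by rewrite -esT => /codomP[w ->]; exists w; rewrite !(adjacent_trace _ _ eqE).
apply/allP=> s; rewrite -esT => /codomP[u ->].
apply/allP=> t; rewrite -esT => /codomP[v ->].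
have [w nadj_w] := nadj u v; apply/hasP; exists (trace es w).
  by rewrite -esT codom_f.
by rewrite -!(adjacent_trace _ _ eqE).
Qed.

Lemma adjacent_refl v : no_isolated E -> adjacent E v v.
Proof.
move/(_ v); rewrite /degree cards_eq0 => /set0Pn[e]; rewrite inE => /andP[Ee ve].
by apply/exists_inP; exists e; rewrite ?ve.
Qed.

(** The upper bound comes from the three traces supplied by [dominated3]. For the lower bound, a set
    of at most two vertices lies in some {u, v}, and a vertex nonadjacent to both u and v is left
    undominated. *)
Lemma domination_number_coded :
  coded es T -> no_isolated E -> undominated T -> dominated3 T ->
  domination_number E = 3.
Proof.
move=> [es_inj esT] no_iso undom dom; rewrite /domination_number.
have dom_all : dominating E [set: V] by apply/forallP=> v; rewrite inE.
case: arg_minnP => // D dom_D min_D; apply/eqP; rewrite eqn_leq; apply/andP; split.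
  case/hasP: dom => i _; set S := take 3 _ => /allP domS.
  have ST t : t \in S -> t \in T by move/mem_take; rewrite mem_filter => /andP[].
  apply: leq_trans (min_D [set v | trace es v \in S] _) _.
    apply/forallP=> v; apply/implyP=> _; apply/exists_inP.
    have /domS/hasP[t /[dup] /ST] : trace es v \in T by rewrite -esT codom_f.
    rewrite -esT => /codomP[u ->] S_u; rewrite -(adjacent_trace _ _ eqE) => adj_uv.
    by exists u; rewrite ?inE.
  rewrite cardE -(size_map (trace es)).
  apply: leq_trans (uniq_leq_size (s2 := S) _ _) _; last by rewrite size_take_min geq_minl.
    by rewrite map_inj_uniq ?enum_uniq //; exact: es_inj.
  by move=> t /mapP[v]; rewrite mem_enum inE => S_v ->.
rewrite leqNgt; apply/negP=> lt_D3.
have [u [v sub_D]] : exists u v, D \subset [set u; v].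
  (* If D is empty, any vertex serves as u and v; one exists because [dominated3] provides a
     nonempty trace. *)
  have [D0 | [u uD]] := set_0Vmem D.
    case/hasP: dom => i /flattenP[t]; rewrite -esT => /codomP[u _] _ _.
    by exists u, u; rewrite D0 sub0set.
  have [Du0 | [v vDu]] := set_0Vmem (D :\ u).
    by exists u, u; rewrite setUid -setD_eq0 Du0.
  exists u, v; apply/subsetP=> w wD; rewrite !inE -implyNb.
  apply/implyP=> w_u; move: lt_D3; rewrite (cardsD1 u) uD (cardsD1 v) vDu.
  rewrite !ltnS leqn0 cards_eq0 => /eqP/setP/(_ w).
  by rewrite !inE w_u wD !andbT => /negbFE.
have [w /andP[nadj_u nadj_v]] := ((undominated_codom esT).1 undom) u v.
have nadj_D x : x \in D -> ~~ adjacent E x w.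
  by move/(subsetP sub_D); rewrite !inE => /orP[] /eqP ->.
have w_D : w \notin D.
  (* Without isolated vertices every vertex is adjacent to itself. *)
  by apply/negP=> /nadj_D; rewrite adjacent_refl.
have /exists_inP[x xD] := implyP (forallP dom_D w) w_D.
by rewrite (negPf (nadj_D _ xD)).
Qed.

End Domination.

Lemma domination_undominated (V : finType) (E : {set {set V}}) u v :
  2 < domination_number E -> exists w, ~~ adjacent E u w && ~~ adjacent E v w.
Proof.
rewrite /domination_number => gt2.
have dom_all : dominating E [set: V] by apply/forallP=> x; rewrite inE.
move: gt2; case: arg_minnP => // D _ min_D gt2.
apply/existsP; apply: contraTT gt2 => /existsPn dom_uv; rewrite -leqNgt.
apply: leq_trans (min_D [set u; v] _) _; last by rewrite cards2; case: (_ != _).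
apply/forallP=> w; apply/implyP=> _; apply/exists_inP.
move: (dom_uv w); rewrite negb_and !negbK => /orP[] adj_w; [exists u|exists v] => //;
by rewrite !inE eqxx ?orbT.
Qed.

(** * Constructions on coded hypergraphs *)

(** Position j of s holds the old label that becomes j. A permutation s reorders the edges; an s
    that omits a label deletes that edge. *)
Definition relabel (s t : seq nat) := [seq j <- iota 0 (size s) | nth 0 s j \in t].

Definition singles (s : seq nat) := [seq [:: i] | i <- s].

(** Any two labels are told apart by some trace, which forces the edges that carry them to be
    different sets. *)
Definition separated m (T : seq (seq nat)) :=
  all (fun i => all (fun j =>
    (i == j) || has (fun t => (i \in t) != (j \in t)) T) (iota 0 m)) (iota 0 m).

Section CodedConstructions.
Variables (V : finType) (es : seq {set V}) (T : seq (seq nat)).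
Hypothesis esT : coded es T.
Implicit Types (E : {set {set V}}) (u v : V).

Let trace_inj : injective (trace es) := proj1 esT.
Let memT v : trace es v \in T.
Proof. by rewrite -(proj2 esT) codom_f. Qed.

Lemma trace_relabel s v :
  trace [seq nth set0 es i | i <- s] v = relabel s (trace es v).
Proof.
rewrite /trace size_map; apply: eq_in_filter => j; rewrite mem_iota /= => lt_j.
by rewrite (nth_map 0) // mem_trace.
Qed.

Lemma coded_relabel s :
  {in T &, injective (relabel s)} ->
  coded [seq nth set0 es i | i <- s] [seq relabel s t | t <- T].
Proof.
move=> s_inj; split=> [u v | t].
  by rewrite !trace_relabel => /s_inj/trace_inj; apply.
apply/codomP/mapP=> [[v ->] | [t' ]].
  by exists (trace es v) => //; rewrite trace_relabel.
by rewrite -(proj2 esT) => /codomP[v ->] ->; exists v; rewrite trace_relabel.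
Qed.

Lemma trace_rcons (f : {set V}) v :
  trace (rcons es f) v =
  if v \in f then rcons (trace es v) (size es) else trace es v.
Proof.
rewrite -cats1 trace_cat; case: ifP => v_f.
  by rewrite (trace_full (es := [:: f])) /= ?addn0 ?cats1 // => e /[!inE] /eqP ->.
rewrite (trace_nil (es := [:: f])) ?cats0 // => e /[!inE] /eqP ->.
by rewrite v_f.
Qed.

(** The new edge receives the label [size es], which occurs in no old trace, so distinct traces stay
    distinct. *)
Lemma coded_rcons (f : {set V}) (S : seq (seq nat)) :
  (forall v, (v \in f) = (trace es v \in S)) ->
  coded (rcons es f) [seq if t \in S then rcons t (size es) else t | t <- T].
Proof.
move=> fS; have traceS v : trace (rcons es f) v =
    (if trace es v \in S then rcons (trace es v) (size es) else trace es v).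
  by rewrite trace_rcons fS.
have no_last v t : trace es v != rcons t (size es).
  apply: contraTneq isT => eq_v; have: size es \in trace es v.
    by rewrite eq_v mem_rcons mem_head.
  by move/trace_lt; rewrite ltnn.
split=> [u v | t].
  rewrite !traceS; case: ifP => _; case: ifP => _ /eqP.
  - by rewrite eqseq_rcons eqxx andbT => /eqP/trace_inj.
  - by rewrite eq_sym (negPf (no_last _ _)).
  - by rewrite (negPf (no_last _ _)).
  - by move/eqP/trace_inj.
apply/codomP/mapP=> [[v ->] | [t' ]].
  by exists (trace es v) => //; rewrite traceS.
by rewrite -(proj2 esT) => /codomP[v ->] ->; exists v; rewrite traceS.
Qed.

Lemma coded_uniq : separated (size es) T -> uniq es.
Proof.
move/allP=> sepT; apply/(uniqP set0) => i j; rewrite !inE => lt_i lt_j eq_ij.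
have label k : k < size es -> k \in iota 0 (size es) by rewrite mem_iota.
have /orP[/eqP // | /hasP[t]] := allP (sepT i (label i lt_i)) j (label j lt_j).
by rewrite -(proj2 esT) => /codomP[v ->]; rewrite !mem_trace eq_ij eqxx.
Qed.

(** Since traces are injective, the trace of x belongs to x alone, and deleting x deletes exactly
    that code. *)
Lemma remove_vertex_coded E x (T' := [seq t <- T | t != trace es x]) :
  E =i es -> exists fs : seq {set {v : V | v != x}},
    [/\ remove_vertex E x =i fs, coded fs T' & size fs = size es].
Proof.
move=> eqE; pose restrict (e : {set V}) : {set {v : V | v != x}} := val @^-1: e.
have trace_restrict (v : {v : V | v != x}) : trace (map restrict es) v = trace es (val v).
  exact: trace_preimset.
exists (map restrict es); split; last by rewrite size_map.
- move=> A; apply/imsetP/mapP=> [[e] | [e]].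
    by rewrite eqE; exists e => //; apply/setP=> v; rewrite !inE.
  by exists e; rewrite ?eqE //; apply/setP=> v; rewrite !inE.
split=> [u v | t]; first by rewrite !trace_restrict => /trace_inj/val_inj.
rewrite mem_filter; apply/codomP/andP=> [[v ->] | [neq_t]].
  by rewrite trace_restrict memT (inj_eq trace_inj) (valP v).
rewrite -(proj2 esT) => /codomP[v def_t]; move: neq_t.
rewrite def_t (inj_eq trace_inj) => neq_v.
by exists (Sub v neq_v); rewrite trace_restrict SubK.
Qed.

(** The vertex attached to the i-th edge has trace [:: i]. The condition on sizes keeps these traces
    apart from the old ones. *)
Lemma add_pendants_coded E :
  E =i es -> uniq es -> all (fun t => size t != 1) T ->
  exists fs, [/\ add_pendants E =i fs,
    coded fs (T ++ singles (iota 0 (size es))) & size fs = size es].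
Proof.
move=> eqE es_uniq sizeT.
(* A description of the extended edge by membership that makes sense for any set e, so that it can
   be mapped over the enumeration [es]. *)
pose pend (e : {set V}) : {set V + {e : {set V} | e \in E}} :=
  [set x | match x with inl v => v \in e | inr f => val f == e end].
have pendE (e : {e : {set V} | e \in E}) :
    pend (val e) = inr e |: [set inl v | v in val e].
  apply/setP=> -[v | f]; rewrite !inE.
    by rewrite mem_imset // => a b [].
  rewrite (inj_eq val_inj); apply/eqP/orP=> [-> | [/eqP[//] | /imsetP[] //]].
  by left.
have trace_inl v : trace (map pend es) (inl v) = trace es v.
  rewrite /trace size_map; apply: eq_in_filter => i; rewrite mem_iota /= => lt_i.
  by rewrite (nth_map set0) // inE.
have es_val (f : {e : {set V} | e \in E}) : val f \in es.
  by rewrite -eqE; exact: (valP f).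
have trace_inr f : trace (map pend es) (inr f) = [:: index (val f) es].
  have es_f := es_val f.
  apply: traceE => // i; rewrite inE; case: (ltnP i (size es)) => lt_i.
    rewrite (nth_map set0) // inE eq_sym -{2}(nth_index set0 es_f).
    by rewrite nth_uniq ?index_mem // eq_sym.
  rewrite nth_default ?size_map // inE; apply: contraTF lt_i => /eqP ->.
  by rewrite -ltnNge index_mem.
have size_inl v : size (trace es v) != 1 by exact: (allP sizeT).
exists (map pend es); split; last by rewrite size_map.
- move=> A; apply/imsetP/mapP=> [[e _ ->] | [e es_e ->]].
    by exists (val e); rewrite ?pendE.
  rewrite -eqE in es_e.
  by exists (Sub e es_e); rewrite // -pendE SubK.
split=> [[u|f] [v|g] | t].
- by rewrite !trace_inl => /trace_inj ->.
- by rewrite trace_inl trace_inr => eq_u; have := size_inl u; rewrite eq_u.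
- by rewrite trace_inl trace_inr => eq_v; have := size_inl v; rewrite -eq_v.
- rewrite !trace_inr => -[eq_i]; congr inr; apply: val_inj.
  by rewrite -(nth_index set0 (es_val f)) eq_i nth_index ?es_val.
rewrite mem_cat; apply/codomP/orP=> [[[v|f] ->] | [|/mapP[i]]].
- by left; rewrite trace_inl.
- right; rewrite trace_inr; apply: map_f.
  by rewrite mem_iota index_mem es_val.
- by rewrite -(proj2 esT) => /codomP[v ->]; exists (inl v); rewrite trace_inl.
rewrite mem_iota => lt_i ->; have E_i : nth set0 es i \in E by rewrite eqE mem_nth.
pose e : {e : {set V} | e \in E} := Sub (nth set0 es i) E_i.
by exists (inr e); rewrite trace_inr SubK index_uniq.
Qed.

End CodedConstructions.

(** * Codes of the Fano hypergraphs *)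

Definition has_codes (V : finType) (E : {set {set V}}) m T :=
  exists es, [/\ E =i es, coded es T & size es = m].

(** Turns isomorphism with a fixed hypergraph into a condition on codes, to which computation
    applies. *)
Lemma isomorphic_has_codes (V W : finType) (E : {set {set V}}) (F : {set {set W}}) m T :
  has_codes F m T -> (isomorphic E F <-> has_codes E m T).
Proof.
move=> [fs [eqF fsT <-]]; split; first exact: isomorphic_coded.
by move=> [es [eqE esT eq_size]]; apply: (coded_isomorphic eqE esT eqF fsT).
Qed.

(* The line with label i consists of the points i, i + 1 and i + 3 mod 7. *)
Definition fano_codes : seq (seq nat) :=
  [seq [seq i <- iota 0 7 | (p + 7 - i) %% 7 \in [:: 0; 1; 3]] | p <- iota 0 7].

Definition F1_codes := fano_codes ++ singles (iota 0 7).

Definition F2_codes i := [seq t <- F1_codes | t != [:: i]].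

(** Omitting j from the list of labels deletes line j and shifts the larger labels down, so the
    labels are again 0, ..., 5. *)
Definition fano_minus_codes j := [seq relabel (rem j (iota 0 7)) t | t <- fano_codes].

Definition F1_minus_codes j := fano_minus_codes j ++ singles (iota 0 6).

Definition F3_codes j (S : seq (seq nat)) :=
  [seq if t \in S then rcons t 6 else t | t <- F1_minus_codes j].

Definition fano_line (i : 'Z_7) : {set 'Z_7} := [set i; (i + 1)%R; (i + 3%:R)%R].

Definition fano_lines := [seq fano_line (inZp i) | i <- iota 0 7].

Lemma mem_fano_lines : fano =i fano_lines.
Proof.
move=> l; apply/imsetP/mapP=> [[i _ ->] | [i _ ->]]; last by exists (inZp i).
by exists (i : nat); rewrite ?mem_iota ?ltn_ord // /fano_line valZpK.
Qed.

Lemma trace_fano_lines p : trace fano_lines p = nth [::] fano_codes p.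
Proof.
have -> : nth [::] fano_codes p =
    [seq i <- iota 0 7 | (p + 7 - i) %% 7 \in [:: 0; 1; 3]].
  by rewrite (nth_map 0) ?size_iota ?nth_iota.
apply: eq_in_filter => i; rewrite mem_iota => lt_i.
rewrite (nth_map 0) ?size_iota ?nth_iota // !inE.
by move: i lt_i p => [|[|[|[|[|[|[|//]]]]]]] _ [[|[|[|[|[|[|[|//]]]]]]] lt_p].
Qed.

Lemma fano_coded : coded fano_lines fano_codes.
Proof.
split=> [p q | t].
  rewrite !trace_fano_lines => /eqP; rewrite nth_uniq ?size_map ?size_iota //.
  by move/eqP/val_inj.
apply/codomP/(nthP [::])=> [[p ->] | [p lt_p <-]].
  by exists (p : nat); rewrite ?trace_fano_lines ?size_map ?size_iota.
by exists (Ordinal lt_p : 'Z_7); rewrite trace_fano_lines.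
Qed.

Lemma uniq_fano_lines : uniq fano_lines.
Proof. by apply: (coded_uniq fano_coded); vm_compute. Qed.

Lemma F1_has_codes : has_codes F1 7 F1_codes.
Proof.
have [//|fs []] := add_pendants_coded fano_coded mem_fano_lines uniq_fano_lines.
by exists fs.
Qed.

Lemma F1_minus_has_codes j (l := nth set0 fano_lines j) :
  j < 7 -> has_codes (F1_minus l) 6 (F1_minus_codes j).
Proof.
move=> lt_j; pose s := rem j (iota 0 7); pose ls := [seq nth set0 fano_lines i | i <- s].
have j7 : j \in iota 0 7 by rewrite mem_iota.
have eq_ls : fano_minus l =i ls.
  move=> e; rewrite in_setD1 mem_fano_lines /ls /s rem_filter ?iota_uniq //.
  apply/andP/mapP=> [[neq_e /(nthP set0)[i lt_i def_e]] | [i]].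
    exists i; rewrite // mem_filter mem_iota lt_i /= !andbT.
    by apply: contraNneq neq_e => eq_ij; rewrite -def_e eq_ij.
  rewrite mem_filter mem_iota => /andP[neq_ij lt_i] ->.
  by rewrite mem_nth // nth_uniq ?uniq_fano_lines.
have: all (fun k => [&& uniq (fano_minus_codes k), separated 6 (fano_minus_codes k),
    size (rem k (iota 0 7)) == 6 &
    all (fun t => size t != 1) (fano_minus_codes k)]) (iota 0 7) by vm_compute.
move/allP/(_ j j7)=> /and4P[uniq_j sep_j /eqP size_s size_j].
have size_ls : size ls = 6 by rewrite size_map.
have ls_coded : coded ls (fano_minus_codes j).
  (* The seven points keep distinct traces after the deletion of line j; this is [uniq_j], checked
     by computation for every line. *)
  apply: (coded_relabel fano_coded) => t t' T_t T_t' eq_t.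
  have: nth [::] (fano_minus_codes j) (index t fano_codes) =
        nth [::] (fano_minus_codes j) (index t' fano_codes).
    by rewrite !(nth_map [::]) ?index_mem // !nth_index.
  move/eqP; rewrite nth_uniq // ?size_map ?[size fano_codes]/= ?index_mem // => /eqP.
  by move/(congr1 (nth [::] fano_codes)); rewrite !nth_index.
have ls_uniq : uniq ls by apply: (coded_uniq ls_coded); rewrite size_ls.
have [fs [eq_fs fs_coded size_fs]] := add_pendants_coded ls_coded eq_ls ls_uniq size_j.
by rewrite size_ls in fs_coded size_fs; exists fs.
Qed.

Lemma is_F1P (V : finType) (E : {set {set V}}) : is_F1 E <-> has_codes E 7 F1_codes.
Proof. exact: isomorphic_has_codes F1_has_codes. Qed.

Lemma F2_has_codes e x : e \in F1 -> x \in e -> degree F1 x = 1 ->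
  exists2 i, i < 7 & has_codes (remove_vertex F1 x) 7 (F2_codes i).
Proof.
have [fs [eqF fsT size_fs]] := F1_has_codes.
have fs_uniq : uniq fs by apply: (coded_uniq fsT); rewrite size_fs.
move=> _ _; rewrite (degree_trace _ fs_uniq eqF).
case def_x: (trace fs x) => [|i []] // _.
have lt_i : i < 7 by rewrite -size_fs (@trace_lt _ _ x) // def_x mem_head.
have [gs [eqG gsT size_gs]] := remove_vertex_coded fsT x eqF.
by exists i => //; rewrite def_x in gsT; exists gs; rewrite size_gs.
Qed.

Lemma F2_codes_is_F2 (V : finType) (E : {set {set V}}) i :
  i < 7 -> has_codes E 7 (F2_codes i) -> is_F2 E.
Proof.
have [fs [eqF fsT size_fs]] := F1_has_codes.
have fs_uniq : uniq fs by apply: (coded_uniq fsT); rewrite size_fs.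
move=> lt_i E_codes.
have: [:: i] \in F1_codes by rewrite mem_cat map_f ?orbT // mem_iota.
rewrite -(proj2 fsT) => /codomP[x def_x].
have fs_i : x \in nth set0 fs i by rewrite -mem_trace -def_x mem_head.
exists (nth set0 fs i), x; split=> //.
- by rewrite eqF mem_nth ?size_fs.
- by rewrite (degree_trace _ fs_uniq eqF) -def_x.
have [gs [eqG gsT size_gs]] := remove_vertex_coded fsT x eqF.
suff x_codes : has_codes (remove_vertex F1 x) 7 (F2_codes i).
  exact/(isomorphic_has_codes E x_codes).
by rewrite -def_x in gsT; exists gs; rewrite size_gs.
Qed.

(* The traces of the vertices of F3's new edge f share no label, that is, no edge
   contains two of these vertices. *)
Definition parallel (S : seq (seq nat)) :=
  all (fun s => all (fun t => (s == t) || ~~ meets s t) S) S.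

Lemma fano_linesP l : l \in fano -> exists2 j, j < 7 & l = nth set0 fano_lines j.
Proof. by rewrite mem_fano_lines => /(nthP set0)[j lt_j <-]; exists j. Qed.

Lemma fano_line_in_fano j : j < 7 -> nth set0 fano_lines j \in fano.
Proof. by move=> lt_j; rewrite mem_fano_lines mem_nth. Qed.

Lemma separated_F1_minus j : j < 7 -> separated 6 (F1_minus_codes j).
Proof.
move=> lt_j; have: all (fun k => separated 6 (F1_minus_codes k)) (iota 0 7) by vm_compute.
by move/allP; apply; rewrite mem_iota.
Qed.

Section F3.
Variables (W : finType) (G : {set {set W}}) (es : seq {set W}) (j : nat).
Hypotheses (lt_j : j < 7) (eqG : G =i es) (esT : coded es (F1_minus_codes j)).
Hypothesis size_es : size es = 6.
Variables x1 x2 x3 x4 : W.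
Let f := [set x1; x2; x3; x4].
Let S := [:: trace es x1; trace es x2; trace es x3; trace es x4].

Lemma mem_F3_edge x : (x \in f) = (trace es x \in S).
Proof. by rewrite !inE -!orbA !(inj_eq (proj1 esT)). Qed.

Lemma degree_F1_minus x : degree G x = size (trace es x).
Proof.
by apply: degree_trace eqG; apply: (coded_uniq esT); rewrite size_es separated_F1_minus.
Qed.

Lemma F3_has_codes : has_codes (f |: G) 7 (F3_codes j S).
Proof.
exists (rcons es f); split; last by rewrite size_rcons size_es.
- by move=> e; rewrite in_setU1 mem_rcons inE eqG.
have := coded_rcons esT mem_F3_edge; rewrite size_es; exact.
Qed.

Lemma parallelP : parallel S <-> forall e, e \in G -> #|e :&: f| <= 1.
Proof.
split=> [/allP parS e | small].
  rewrite eqG => /(nthP set0)[i lt_i <-].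
  apply/card_le1P=> x; rewrite inE => /andP[x_i x_f] y; rewrite !inE.
  apply/idP/eqP=> [/andP[y_i y_f] | ->]; last by move: x_i x_f; rewrite !inE => -> ->.
  apply: (proj1 esT).
  have y_f' : y \in f by rewrite !inE.
  rewrite !mem_F3_edge in x_f y_f'.
  have /orP[/eqP // | /hasP[]] := allP (parS _ y_f') _ x_f.
  by exists i; rewrite /= mem_trace.
have S_f t : t \in S -> exists2 x, x \in f & t = trace es x.
  rewrite !inE => /or4P[] /eqP ->; [exists x1|exists x2|exists x3|exists x4] => //;
  by rewrite !inE eqxx ?orbT.
apply/allP=> _ /S_f[x x_f ->]; apply/allP=> _ /S_f[y y_f ->].
rewrite -implyNb; apply/implyP=> neq_xy; apply/hasPn=> i /=.
move=> /[dup] /trace_lt lt_i; rewrite !mem_trace => x_i; apply/negP=> y_i.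
have /card_le1_eqP eq_all := small (nth set0 es i) (etrans (eqG _) (mem_nth _ lt_i)).
by case/eqP: neq_xy; rewrite (eq_all x y) // inE ?x_i ?y_i.
Qed.

End F3.

(* Nested conditionals, because the virtual machine evaluates both arguments of a
   boolean connective. *)
Definition all_F3_edges j (P : seq (seq nat) -> bool) :=
  let pairs := [seq t <- F1_minus_codes j | size t == 2] in
  let pends := [seq t <- F1_minus_codes j | size t == 1] in
  all (fun t1 => all (fun t2 => all (fun t3 => all (fun t4 =>
    if uniq [:: t1; t2; t3; t4] then
      if parallel [:: t1; t2; t3; t4] then P [:: t1; t2; t3; t4] else true
    else true) pends) pends) pairs) pairs.

(** Exhausts the deleted line and all admissible choices of the new edge, so no symmetry argument is
    needed to see that the choice in [is_F3] is harmless. *)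
Lemma F3_codes_domination :
  all (fun j => all_F3_edges j
    (fun S => undominated (F3_codes j S) && dominated3 (F3_codes j S))) (iota 0 7).
Proof. by vm_compute. Qed.

Lemma has_codes_domination (V : finType) (E : {set {set V}}) m T :
  no_isolated E -> undominated T && dominated3 T -> has_codes E m T ->
  domination_number E = 3.
Proof.
move=> no_iso /andP[undom dom] [es [eqE esT _]].
exact: domination_number_coded eqE esT no_iso undom dom.
Qed.

Lemma is_F3_domination (V : finType) (E : {set {set V}}) :
  no_isolated E -> is_F3 E -> domination_number E = 3.
Proof.
move=> no_iso [_ [/fano_linesP[j lt_j ->] [x1 [x2 [x3 [x4 []]]]]]].
move=> x_uniq small [deg1 deg2] [deg3 deg4].
have [es [eqG esT size_es]] := F1_minus_has_codes lt_j.
rewrite !(degree_F1_minus lt_j eqG esT size_es) in deg1 deg2 deg3 deg4.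
move/(isomorphic_has_codes E (F3_has_codes eqG esT size_es x1 x2 x3 x4)).
apply: has_codes_domination => //.
have memT x : trace es x \in F1_minus_codes j by rewrite -(proj2 esT) codom_f.
have /allP/(_ j) := F3_codes_domination; rewrite mem_iota => /(_ lt_j).
move/allP/(_ (trace es x1)); rewrite mem_filter deg1 memT => /(_ isT).
move/allP/(_ (trace es x2)); rewrite mem_filter deg2 memT => /(_ isT).
move/allP/(_ (trace es x3)); rewrite mem_filter deg3 memT => /(_ isT).
move/allP/(_ (trace es x4)); rewrite mem_filter deg4 memT => /(_ isT).
rewrite (map_inj_uniq (proj1 esT) [:: x1; x2; x3; x4]) x_uniq.
by rewrite ((parallelP eqG esT x1 x2 x3 x4).2 small).
Qed.

Lemma F3_codes_is_F3 (V : finType) (E : {set {set V}}) :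
  has_codes E 7 (F3_codes 6 [:: [:: 3; 5]; [:: 0; 4]; [:: 1]; [:: 2]]) -> is_F3 E.
Proof.
move=> E_codes; have lt_6 : 6 < 7 by [].
have [es [eqG esT size_es]] := F1_minus_has_codes lt_6.
have ex_x t : t \in F1_minus_codes 6 -> exists x, trace es x = t.
  by rewrite -(proj2 esT) => /codomP[x ->]; exists x.
have [x1 def1] : exists x, trace es x = [:: 3; 5] by apply: ex_x; vm_compute.
have [x2 def2] : exists x, trace es x = [:: 0; 4] by apply: ex_x; vm_compute.
have [x3 def3] : exists x, trace es x = [:: 1] by apply: ex_x; vm_compute.
have [x4 def4] : exists x, trace es x = [:: 2] by apply: ex_x; vm_compute.
exists (nth set0 fano_lines 6); split; first exact: fano_line_in_fano.
exists x1, x2, x3, x4; split.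
- by rewrite -(map_inj_uniq (proj1 esT)) /= def1 def2 def3 def4.
- by apply/(parallelP eqG esT); rewrite def1 def2 def3 def4.
- by rewrite !(degree_F1_minus lt_6 eqG esT size_es) def1 def2.
- by rewrite !(degree_F1_minus lt_6 eqG esT size_es) def3 def4.
have := F3_has_codes eqG esT size_es x1 x2 x3 x4; rewrite def1 def2 def3 def4.
by move/(isomorphic_has_codes E) => [_]; apply.
Qed.

Lemma F_domination (V : finType) (E : {set {set V}}) :
  no_isolated E -> is_F1 E \/ is_F1_minus E \/ is_F2 E \/ is_F3 E ->
  domination_number E = 3.
Proof.
move=> no_iso [|[|[|]]].
- by move/is_F1P; apply: has_codes_domination => //; vm_compute.
- case=> _ /fano_linesP[j lt_j ->].
  move/(isomorphic_has_codes E (F1_minus_has_codes lt_j)).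
  apply: has_codes_domination => //.
  have: all (fun k => undominated (F1_minus_codes k) && dominated3 (F1_minus_codes k))
    (iota 0 7) by vm_compute.
  by move/allP; apply; rewrite mem_iota.
- case=> e [x [F1_e x_e deg_x]].
  have [i lt_i x_codes] := F2_has_codes F1_e x_e deg_x.
  move/(isomorphic_has_codes E x_codes); apply: has_codes_domination => //.
  have: all (fun k => undominated (F2_codes k) && dominated3 (F2_codes k))
    (iota 0 7) by vm_compute.
  by move/allP; apply; rewrite mem_iota.
exact: is_F3_domination.
Qed.

(** * Degrees in a linear intersecting hypergraph with domination number above 2 *)

Section Structure.
Variables (V : finType) (E : {set {set V}}).
Hypotheses (linE : linear_hypergraph E) (intE : intersecting E).
Hypotheses (no_iso : no_isolated E) (card_le4 : forall e, e \in E -> #|e| <= 4).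
Implicit Types (u v w x y : V) (e f : {set V}).

Definition star v := [set e in E | v \in e].

Lemma star_edge v : exists2 e, e \in E & v \in e.
Proof.
move: (no_iso v); rewrite /degree cards_eq0 => /set0Pn[e].
by rewrite inE => /andP[Ee v_e]; exists e.
Qed.

Lemma edges_meet e f : e \in E -> f \in E -> exists2 x, x \in e & x \in f.
Proof.
by move=> Ee Ef; have /set0Pn[x /setIP[]] := intE Ee Ef; exists x.
Qed.

Lemma edges_meet_once e f x y :
  e \in E -> f \in E -> e != f ->
  x \in e -> x \in f -> y \in e -> y \in f -> x = y.
Proof.
move=> Ee Ef neq_ef xe xf ye yf; have /card_le1_eqP := linE Ee Ef neq_ef.
by apply; rewrite inE ?xe ?ye.
Qed.

Lemma adjacentC u v : adjacent E u v = adjacent E v u.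
Proof. by apply: eq_existsb => e; rewrite [(u \in e) && _]andbC. Qed.

Lemma nonadjacent_edge u v e :
  ~~ adjacent E u v -> e \in E -> u \in e -> v \notin e.
Proof.
move/exists_inPn=> nadj Ee ue; apply/negP=> ve.
by case/negP: (nadj e Ee); rewrite ue.
Qed.

(* Edges through x meet f in distinct vertices, all of them adjacent to x. *)
Lemma degree_add_nonadjacent x f (A : {set V}) :
  f \in E -> x \notin f -> A \subset f -> {in A, forall a, ~~ adjacent E x a} ->
  degree E x + #|A| <= #|f|.
Proof.
move=> Ef x_f sAf nadj.
pose h e := odflt x [pick y in e :&: f].
have hP e : e \in star x -> h e \in e /\ h e \in f.
  rewrite inE => /andP[Ee _]; rewrite /h; case: pickP => [y /setIP[] // | none].
  by have [y ye yf] := edges_meet Ee Ef; have := none y; rewrite inE ye yf.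
(* Two edges through x with the same image would share both x and that image, which differ because x
   is not on f. *)
have h_inj : {in star x &, injective h}.
  move=> e e' /[dup] /hP[he hf]; rewrite inE => /andP[Ee xe].
  move=> /[dup] /hP[he' _]; rewrite inE => /andP[Ee' xe'] eq_h.
  apply: contraNeq x_f => neq_ee'; rewrite -eq_h in he'.
  by rewrite (edges_meet_once Ee Ee' neq_ee' xe xe' he he').
have sub_h : h @: star x \subset f :\: A.
  apply/subsetP=> _ /imsetP[e /[dup] /hP[he hf] /[!inE] /andP[Ee xe] ->].
  rewrite hf andbT; apply/negP=> /nadj /nonadjacent_edge/(_ Ee xe).
  by rewrite he.
move/subset_leq_card: sub_h; rewrite card_in_imset // cardsD (setIidPr sAf).
by rewrite leq_subRL ?subset_leq_card // addnC.
Qed.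

Hypothesis undom : forall u v, exists w, ~~ adjacent E u w && ~~ adjacent E v w.

Lemma nonadjacent_degree u v f : f \in E -> u \in f -> ~~ adjacent E v u -> degree E v <= 3.
Proof.
move=> Ef uf nadj; have := @degree_add_nonadjacent v f [set u] Ef.
rewrite cards1 sub1set uf => le_f; have := card_le4 Ef; suff: degree E v + 1 <= #|f| by lia.
apply: le_f => // [|a /set1P -> //].
by apply: nonadjacent_edge uf; rewrite // adjacentC.
Qed.

Lemma degree_le3 v : degree E v <= 3.
Proof.
have [w /andP[nadj _]] := undom v v; have [f Ef wf] := star_edge w.
exact: nonadjacent_degree Ef wf nadj.
Qed.

Lemma degree_gt0 v : 0 < degree E v.
Proof. by rewrite lt0n. Qed.

(** All edges meet a fixed edge e through v. Those that avoid v pass through one of the at most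
    three other vertices of e, each of which lies on at most d edges besides e. *)
Lemma card_edges_le d v : (forall u, degree E u <= d.+1) -> #|E| <= degree E v + d * 3.
Proof.
move=> deg_le; have [e Ee ve] := star_edge v.
have subE : E \subset star v :|: \bigcup_(u in e :\ v) (star u :\ e).
  apply/subsetP=> f Ef; have [u ue uf] := edges_meet Ee Ef.
  have [vf | nvf] := boolP (v \in f); first by rewrite !inE Ef vf.
  rewrite inE; apply/orP; right; apply/bigcupP; exists u.
    by rewrite !inE ue andbT; apply: contraNneq nvf => <-.
  by rewrite !inE Ef uf !andbT; apply: contraNneq nvf => ->.
apply: leq_trans (subset_leq_card subE) (leq_trans (leq_card_setU _ _) _).
rewrite leq_add2l; apply: leq_trans (_ : \sum_(u in e :\ v) d <= _).
  elim/big_rec2: _ => [|u A n /setD1P[_ ue] le_A]; first by rewrite cards0.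
  apply: leq_trans (leq_card_setU _ _) (leq_add _ le_A).
  by move: (deg_le u); rewrite /degree -/(star u) (cardsD1 e) !inE Ee ue.
rewrite sum_nat_const mulnC leq_mul2l.
by have := card_le4 Ee; rewrite (cardsD1 v) ve ltnS => ->; rewrite orbT.
Qed.

Definition pencils (vs : seq V) := flatten [seq enum (star v) | v <- vs].

Lemma mem_pencils vs e : (e \in pencils vs) = (e \in E) && has (fun v => v \in e) vs.
Proof.
apply/flatten_mapP/andP=> [[v vs_v] | [Ee /hasP[v vs_v ve]]].
  by rewrite mem_enum inE => /andP[-> ve]; split=> //; apply/hasP; exists v.
by exists v; rewrite // mem_enum inE Ee.
Qed.

Lemma uniq_pencils vs : pairwise (fun u v => ~~ adjacent E u v) vs -> uniq (pencils vs).
Proof.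
elim: vs => //= v vs IHvs /andP[/allP nadj_v /IHvs uniq_vs].
rewrite cat_uniq enum_uniq uniq_vs andbT; apply/hasPn=> e; rewrite mem_pencils mem_enum.
case/andP=> Ee /hasP[u vs_u ue]; rewrite inE Ee /=.
by apply: contraL ue => /(nonadjacent_edge (nadj_v u vs_u) Ee).
Qed.

Lemma sum_degrees_le vs :
  pairwise (fun u v => ~~ adjacent E u v) vs -> sumn (map (degree E) vs) <= #|E|.
Proof.
move/uniq_pencils=> vs_uniq.
have -> : sumn (map (degree E) vs) = size (pencils vs).
  rewrite size_flatten /shape -map_comp; congr sumn; apply: eq_map => v /=.
  by rewrite -cardE.
rewrite cardE; apply: uniq_leq_size => // e; rewrite mem_pencils mem_enum.
by case/andP.
Qed.

(** Suppose all degrees are at most 2. Some x has degree 2, being common to two edges, and three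
    further edges avoid x, so there are at least 5 edges. As [card_edges_le] now bounds their number
    by 3 plus any degree, w1 and w2 have degree 2 and there are at most 5 edges, while the disjoint
    pencils of x, w1, w2 contain 6. *)
Lemma exists_degree3 v0 : exists x, degree E x = 3.
Proof.
have [x /eqP | no3] := pickP (fun x => degree E x == 3); first by exists x.
have le2 u : degree E u <= 2.
  by have := degree_le3 u; have := no3 u; case: ltngtP.
have [w /andP[nadj _]] := undom v0 v0.
have [[e Ee v0e] [f Ef wf]] := (star_edge v0, star_edge w).
have neq_ef : e != f by apply: contraTneq wf => <-; exact: nonadjacent_edge nadj Ee v0e.
have [x xe xf] := edges_meet Ee Ef.
have ge2 : 2 <= degree E x.
  have /subset_leq_card : [set e; f] \subset star x.
    by apply/subsetP=> g /set2P[] ->; rewrite !inE ?Ee ?Ef.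
  by rewrite cards2 neq_ef.
have [w1 /andP[nadj_x1 _]] := undom x x.
have [w2 /andP[nadj_x2 nadj_12]] := undom x w1.
have [[f1 Ef1 w1f1] [f2 Ef2 w2f2]] := (star_edge w1, star_edge w2).
have [y yf1 yf2] := edges_meet Ef1 Ef2.
have [w3 /andP[nadj_x3 nadj_y3]] := undom x y.
have [f3 Ef3 w3f3] := star_edge w3.
have := sum_degrees_le (vs := [:: x; w1; w2]).
rewrite /= nadj_x1 nadj_x2 nadj_12 => /(_ isT).
have := card_edges_le x le2; have := card_edges_le w1 le2; have := card_edges_le w2 le2.
have := le2 x.
suff: degree E x + 3 <= #|E|.
  by move: ge2; move: (degree E x) (degree E w1) (degree E w2) #|E|; clear; lia.
have out u g : ~~ adjacent E x u -> g \in E -> u \in g -> g \notin star x.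
  by rewrite adjacentC inE => nadj_u Eg ug; rewrite Eg (nonadjacent_edge nadj_u Eg ug).
(* f1 misses w2, and f1 and f2 both contain y, so neither contains w3. *)
have uniq_f : uniq [:: f1; f2; f3].
  rewrite /= !inE !andbT negb_or -andbA; apply/and3P; split.
  - by apply: contraTneq w2f2 => <-; exact: nonadjacent_edge nadj_12 Ef1 w1f1.
  - by apply: contraTneq w3f3 => <-; exact: nonadjacent_edge nadj_y3 Ef1 yf1.
  - by apply: contraTneq w3f3 => <-; exact: nonadjacent_edge nadj_y3 Ef2 yf2.
rewrite /degree -/(star x) !cardE -(size_cat _ [:: f1; f2; f3]).
apply: uniq_leq_size.
  rewrite cat_uniq enum_uniq uniq_f andbT; apply/hasPn=> g.
  rewrite !inE mem_enum => /or3P[] /eqP ->.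
  - exact: out nadj_x1 Ef1 w1f1.
  - exact: out nadj_x2 Ef2 w2f2.
  - exact: out nadj_x3 Ef3 w3f3.
move=> g; rewrite mem_cat !mem_enum => /orP[/[!inE] /andP[] //|].
by rewrite !inE => /or3P[] /eqP ->.
Qed.

Lemma nonadjacent_triple x :
  degree E x = 3 ->
  exists w1 w2 w3, pairwise (fun u v => ~~ adjacent E u v) [:: x; w1; w2; w3].
Proof.
move=> deg_x.
(* An edge through both w and w' would have at least 3 + 2 vertices by [degree_add_nonadjacent]. *)
have nadj_ww w w' :
    w != w' -> ~~ adjacent E x w -> ~~ adjacent E x w' -> ~~ adjacent E w w'.
  move=> neq_w nadj nadj'; apply/exists_inPn=> f Ef; apply/negP=> /andP[wf w'f].
  have := @degree_add_nonadjacent x f [set w; w'] Ef.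
  rewrite deg_x cards2 neq_w => le_f; have := card_le4 Ef; suff: 5 <= #|f| by lia.
  apply: le_f; first by apply: nonadjacent_edge wf; rewrite // adjacentC.
    by apply/subsetP=> z /set2P[] ->.
  by move=> z /set2P[] ->.
have [w1 /andP[nadj_x1 _]] := undom x x.
have [w2 /andP[nadj_x2 nadj_12]] := undom x w1.
have [[f1 Ef1 w1f1] [f2 Ef2 w2f2]] := (star_edge w1, star_edge w2).
have [y yf1 yf2] := edges_meet Ef1 Ef2.
(* Being nonadjacent to y, the vertex w3 lies on neither f1 nor f2, so it differs from w1 and w2. *)
have [w3 /andP[nadj_x3 nadj_y3]] := undom x y.
have neq_w3 f z : f \in E -> y \in f -> z \in f -> z != w3.
  by move=> Ef yf zf; apply: contraNneq (nonadjacent_edge nadj_y3 Ef yf) => <-.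
have nadj_13 := nadj_ww _ _ (neq_w3 _ _ Ef1 yf1 w1f1) nadj_x1 nadj_x3.
have nadj_23 := nadj_ww _ _ (neq_w3 _ _ Ef2 yf2 w2f2) nadj_x2 nadj_x3.
by exists w1, w2, w3; rewrite /= nadj_x1 nadj_x2 nadj_x3 nadj_12 nadj_13 nadj_23.
Qed.

(** Comparing 3 + d1 + d2 + d3 <= m with m <= di + 6 shows that any two of the degrees sum to at
    most 3. Hence at most one of them is 2 and the others are 1; the three cases below only reorder
    the vertices. *)
Lemma nonadjacent_triple_degrees x :
  degree E x = 3 ->
  exists w1 w2 w3, [/\ pairwise (fun u v => ~~ adjacent E u v) [:: x; w1; w2; w3],
    degree E w1 = 1, degree E w2 = 1 &
    degree E w3 = 1 /\ (#|E| = 6 \/ #|E| = 7) \/ degree E w3 = 2 /\ #|E| = 7].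
Proof.
move=> deg_x; have [w1 [w2 [w3 nadj]]] := nonadjacent_triple deg_x.
have [/and4P[n1 n2 n3 _] /andP[/and3P[n12 n13 _] /andP[/andP[n23 _] _]]] := andP nadj.
have bounds w : 0 < degree E w /\ #|E| <= degree E w + 6.
  by split; [exact: degree_gt0 | exact: card_edges_le degree_le3].
have := sum_degrees_le nadj; rewrite /= deg_x.
move: (bounds w1) (bounds w2) (bounds w3).
move def1: (degree E w1) => d1; move def2: (degree E w2) => d2.
move def3: (degree E w3) => d3; move: #|E| => m.
move=> [gt1 le1] [gt2 le2] [gt3 le3] sum_le.
pose last d := d = 1 /\ (m = 6 \/ m = 7) \/ d = 2 /\ m = 7.
have [] : [\/ [/\ d1 = 1, d2 = 1 & last d3], [/\ d2 = 1, d3 = 1 & last d1]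
             | [/\ d1 = 1, d3 = 1 & last d2]].
  rewrite /last; move: gt1 le1 gt2 le2 gt3 le3 sum_le; clear.
  move=> *; have [|[|]] : d1 = 1 /\ d2 = 1 \/ d2 = 1 /\ d3 = 1 \/ d1 = 1 /\ d3 = 1.
  - by lia.
  - by constructor 1; split; lia.
  - by constructor 2; split; lia.
  by constructor 3; split; lia.
- by case=> eq1 eq2 last3; exists w1, w2, w3; rewrite def1 def2 def3.
- case=> eq2 eq3 last1; exists w2, w3, w1; rewrite def1 def2 def3 /=.
  by rewrite n1 n2 n3 n23 !(adjacentC _ w1) n12 n13.
case=> eq1 eq3 last2; exists w1, w3, w2; rewrite def1 def2 def3 /=.
by rewrite n1 n2 n3 n12 n13 (adjacentC _ w2) n23.
Qed.

End Structure.

(** * Search for the codes *)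

(** The first condition is linearity, by which two vertices share at most one edge; the second is
    the bound of four vertices per edge. *)
Definition fits m (b : seq nat) (B : seq (seq nat)) :=
  all (fun c => count (mem c) b <= 1) B &&
  all (fun l => count (fun c : seq nat => l \in c) (b :: B) <= 4) (iota 0 m).

(* Extends B by traces of size 2 or 3 until every pair of labels in ps lies in a
   common trace; k = i gives the trace {i, j} of size 2. *)
Fixpoint completions m (ps : seq (nat * nat)) (B : seq (seq nat)) :=
  if ps is (i, j) :: ps' then
    if has (fun b : seq nat => (i \in b) && (j \in b)) B then completions m ps' B
    else flatten [seq completions m ps' (b :: B) |
      b <- [seq [seq l <- iota 0 m | l \in [:: i; j; k]] | k <- iota 0 m & k != j]
      & fits m b B]
  else [:: B].

Definition label_pairs m :=
  [seq p <- [seq (i, j) | i <- iota 0 m, j <- iota 0 m] | p.1 < p.2].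

Fixpoint sublists (s : seq nat) :=
  if s is x :: s' then sublists s' ++ [seq x :: t | t <- sublists s'] else [:: [::]].

(** The edges that still have room for a vertex of degree 1 not recorded in B. *)
Definition free_labels m (B : seq (seq nat)) :=
  [seq l <- iota 0 m | ([:: l] \notin B) && (count (fun c : seq nat => l \in c) B < 4)].

Definition same_codes (T T' : seq (seq nat)) := all (mem T') T && all (mem T) T'.

(* [find _ perms < size perms] is [has _ perms], but stops at the first success
   when run by the virtual machine. *)
Definition classified m B0 (perms : seq (seq nat)) (targets : seq (seq (seq nat))) :=
  all (fun B => all (fun P =>
    let T := B ++ singles P in
    if undominated T then
      find (fun s => has (same_codes [seq relabel s t | t <- T]) targets) perms
        < size perms
    else true) (sublists (free_labels m B))) (completions m (label_pairs m) B0).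

(* As edges have at most 4 vertices, an edge carrying at least 4 distinct traces
   has no two vertices with the same trace. *)
Definition pendants_full (T : seq (seq nat)) :=
  all (fun t => if t is [:: i] then 3 < count (fun c : seq nat => i \in c) (undup T)
                else 1 < size t) T.

Lemma filter_sublists p s : filter p s \in sublists s.
Proof.
elim: s => //= x s IHs; rewrite mem_cat.
by case: (p x); rewrite ?IHs // map_f ?orbT.
Qed.

(** * Soundness of the search *)

Section Search.
Variables (V : finType) (E : {set {set V}}) (es : seq {set V}).
Hypotheses (linE : linear_hypergraph E) (intE : intersecting E).
Hypotheses (no_iso : no_isolated E) (card_le4 : forall e, e \in E -> #|e| <= 4).
Hypothesis undom : forall u v, exists w, ~~ adjacent E u w && ~~ adjacent E v w.
Hypotheses (es_uniq : uniq es) (eqE : E =i es).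
Implicit Types (u v : V) (B T : seq (seq nat)).

Let E_nth i : i < size es -> nth set0 es i \in E.
Proof. by move=> lt_i; rewrite eqE mem_nth. Qed.

Lemma size_trace_bounds v : 0 < size (trace es v) <= 3.
Proof.
rewrite -(degree_trace _ es_uniq eqE) (degree_gt0 no_iso).
exact: degree_le3.
Qed.

Lemma trace_meet_inj u v i j :
  i != j -> i \in trace es u -> j \in trace es u ->
  i \in trace es v -> j \in trace es v -> u = v.
Proof.
move=> neq_ij /[dup] /trace_lt lt_i u_i /[dup] /trace_lt lt_j u_j v_i v_j.
rewrite !mem_trace in u_i u_j v_i v_j.
by apply: (edges_meet_once linE (E_nth lt_i) (E_nth lt_j)); rewrite ?nth_uniq.
Qed.

Lemma trace_meet_le1 u v : u != v -> count (mem (trace es u)) (trace es v) <= 1.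
Proof.
move=> neq_uv; rewrite -size_filter leqNgt; apply/negP.
have := filter_uniq (mem (trace es u)) (trace_uniq es v).
have sub i : i \in [seq j <- trace es v | mem (trace es u) j] ->
  i \in trace es u /\ i \in trace es v by rewrite mem_filter => /andP[].
case: filter sub => [|i [|j s]] // sub; rewrite /= inE negb_or.
move=> /andP[/andP[neq_ij _] _] _.
have [ui vi] := sub i (mem_head _ _).
have [uj vj] : j \in trace es u /\ j \in trace es v by apply: sub; rewrite !inE eqxx orbT.
by rewrite (trace_meet_inj neq_ij ui uj vi vj) eqxx in neq_uv.
Qed.

(** Distinct traces containing l come from distinct vertices of edge l. *)
Lemma count_label_le4 B l :
  uniq B -> {subset B <= codom (trace es)} -> l < size es ->
  count (fun c : seq nat => l \in c) B <= 4.
Proof.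
move=> B_uniq subB lt_l; rewrite -size_filter.
apply: leq_trans (card_le4 (E_nth lt_l)); rewrite cardE -(size_map (trace es)).
apply: uniq_leq_size; first exact: filter_uniq.
move=> c; rewrite mem_filter => /andP[l_c /subB/codomP[v def_c]].
by rewrite def_c map_f // mem_enum -mem_trace -def_c.
Qed.

(** Follows the branch of the search in which each uncovered pair {i, j} receives the trace of an
    actual common vertex of the edges i and j. *)
Lemma completions_sound ps B :
  uniq B -> {subset B <= codom (trace es)} ->
  {in ps, forall p, p.1 < p.2 < size es} ->
  exists B', [/\ B' \in completions (size es) ps B, uniq B',
    {subset B' <= codom (trace es)}, {subset B <= B'} &
    {in ps, forall p, has (fun b : seq nat => (p.1 \in b) && (p.2 \in b)) B'}].
Proof.
elim: ps B => [|[i j] ps IHps] B B_uniq subB lt_ps.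
  by exists B; split; rewrite ?mem_head.
have lt_ps' : {in ps, forall p, p.1 < p.2 < size es}.
  by move=> p ps_p; apply: lt_ps; rewrite inE ps_p orbT.
have /andP[/= lt_ij lt_j] := lt_ps _ (mem_head _ _).
rewrite /=; case: ifP => [covered | uncovered].
  have [B' [B'_in B'_uniq subB' subBB' cov]] := IHps B B_uniq subB lt_ps'.
  exists B'; split=> // p; rewrite inE => /orP[/eqP -> /= | /cov //].
  case/hasP: covered => b /subBB' B'_b ij_b.
  by apply/hasP; exists b.
have lt_i := ltn_trans lt_ij lt_j.
have [v vi vj] := edges_meet intE (E_nth lt_i) (E_nth lt_j).
rewrite -!mem_trace in vi vj; pose b := trace es v.
have B_b : b \notin B.
  by apply: contraFN uncovered => B_b; apply/hasP; exists b; rewrite ?vi.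
have bB_uniq : uniq (b :: B) by rewrite /= B_b.
have subbB : {subset b :: B <= codom (trace es)}.
  by move=> c; rewrite inE => /orP[/eqP -> | /subB //]; exact: codom_f.
have [B' [B'_in B'_uniq subB' subBB' cov]] := IHps _ bB_uniq subbB lt_ps'.
exists B'; split=> //; last 2 first.
- by move=> c B_c; apply: subBB'; rewrite inE B_c orbT.
- move=> p; rewrite inE => /orP[/eqP -> /= | /cov //].
  by apply/hasP; exists b; rewrite ?vi // subBB' ?mem_head.
apply/flatten_mapP; exists b => //; rewrite mem_filter; apply/andP; split.
  apply/andP; split; apply/allP=> c.
    move=> /[dup] B_c /subB/codomP[u def_c]; rewrite def_c trace_meet_le1 //.
    by apply: contraNneq B_b => eq_uv; rewrite /b -eq_uv -def_c.
  by rewrite mem_iota => lt_c; exact: count_label_le4.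
(* Degrees are at most 3, so b has at most one label k besides i and j; if there is none, k = i. *)
have [k [neq_kj lt_k bE]] : exists k, [/\ k != j, k < size es & b =i [:: i; j; k]].
  have size_b : size b <= 3 by have /andP[] := size_trace_bounds v.
  pose r := [seq l <- b | l \notin [:: i; j]].
  have size_r : size r <= 1.
    have: size [seq l <- b | l \in [:: i; j]] >= 2.
      apply: (@uniq_leq_size _ [:: i; j]); first by rewrite /= inE neq_ltn lt_ij.
      by move=> l; rewrite mem_filter => ij_l; rewrite ij_l; move: ij_l;
        rewrite !inE => /orP[] /eqP ->.
    move=> ge2; rewrite -(leq_add2l 2); apply: leq_trans size_b.
    rewrite -(count_predC (mem [:: i; j]) b) /r size_filter leq_add2r.
    by rewrite size_filter in ge2.
  have in_r l : (l \in b) = (l \in [:: i; j]) || (l \in r).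
    have [|ij_l] := boolP (l \in [:: i; j]); last by rewrite [l \in r]mem_filter ij_l.
    by rewrite !inE => /orP[] /eqP ->; rewrite ?vi ?vj.
  case def_r: r size_r in_r => [|k []] // _ in_r.
    exists i; rewrite neq_ltn lt_ij; split=> // l.
    by rewrite in_r !inE orbF; case: (l == i); rewrite ?orbT ?orbF.
  have: k \in r by rewrite def_r mem_head.
  rewrite mem_filter !inE negb_or => /andP[/andP[_ neq_kj] /trace_lt lt_k].
  by exists k; split=> // l; rewrite in_r !inE orbA.
apply/mapP; exists k; first by rewrite mem_filter neq_kj mem_iota.
by apply: trace_filter => l _; rewrite -mem_trace -/b bE.
Qed.

(** A trace with two labels i < j already lies in B: the pair is covered there by the trace of some
    vertex, and by linearity that vertex is the same. The traces missing from B are therefore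
    singletons, collected in P. *)
Lemma search_sound B0 :
  uniq B0 -> {subset B0 <= codom (trace es)} ->
  exists B P, [/\ B \in completions (size es) (label_pairs (size es)) B0,
    P \in sublists (free_labels (size es) B) &
    codom (trace es) =i B ++ singles P].
Proof.
move=> B0_uniq subB0.
have lt_pairs : {in label_pairs (size es), forall p, p.1 < p.2 < size es}.
  move=> p; rewrite mem_filter => /andP[-> /allpairsP[[i j]] /= [_ ]].
  by rewrite mem_iota => lt_j ->.
have [B [B_in B_uniq subB _ cov]] := completions_sound B0_uniq subB0 lt_pairs.
pose P := [seq i <- free_labels (size es) B | [:: i] \in codom (trace es)].
exists B, P; split; rewrite ?filter_sublists // => t.
rewrite mem_cat; apply/idP/orP=> [codom_t | [/subB //|/mapP[i]]]; last first.
  by rewrite mem_filter => /andP[codom_i _] ->.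
have [B_t | B_t] := boolP (t \in B); [by left | right].
have [v def_t] := codomP codom_t.
have := size_trace_bounds v; rewrite -def_t.
case def_ij: t => [|i [|j t']] // _.
  rewrite def_ij in def_t codom_t B_t.
  apply: map_f; rewrite mem_filter codom_t mem_filter B_t mem_iota /=.
  have lt_i : i < size es by rewrite (@trace_lt _ _ v) // -def_t mem_head.
  have iB_uniq : uniq ([:: i] :: B) by rewrite /= B_t.
  rewrite lt_i andbT; have := count_label_le4 iB_uniq _ lt_i.
  rewrite /= mem_head add1n; apply => c; rewrite inE => /orP[/eqP -> // | /subB //].
have ti : i \in t by rewrite def_ij mem_head.
have tj : j \in t by rewrite def_ij !inE eqxx orbT.
have lt_ij : i < j by have := trace_sorted es v; rewrite -def_t def_ij /= => /andP[].
rewrite def_t in ti tj; case/negP: B_t.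
have /cov/hasP[b /[dup] B_b /subB/codomP[u def_b]] : (i, j) \in label_pairs (size es).
  rewrite mem_filter /= lt_ij; apply: allpairs_f; rewrite mem_iota ?(trace_lt ti) //.
  exact: trace_lt tj.
rewrite def_b /= => /andP[ui uj].
suff eq_vu : v = u by rewrite def_t eq_vu -def_b.
by apply: trace_meet_inj ti tj ui uj; rewrite neq_ltn lt_ij.
Qed.

Lemma coded_pendants_full T :
  codom (trace es) =i T -> pendants_full T -> coded es T.
Proof.
move=> esT /allP fullT; split=> // u v eq_uv.
have: trace es u \in T by rewrite -esT codom_f.
move/fullT; case def_u: (trace es u) => [|i [|j t]] //.
  move=> full_i; have ui : i \in trace es u by rewrite def_u mem_head.
  have lt_i := trace_lt ui; pose e := nth set0 es i.
  (* At most four vertices of e realise at least four distinct traces, so no trace is repeated on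
     e. *)
  have e_uniq : uniq [seq trace es w | w <- enum e].
    apply: leq_size_uniq (filter_uniq (fun c : seq nat => i \in c) (undup_uniq T)) _ _.
      move=> c; rewrite mem_filter mem_undup -esT => /andP[i_c /codomP[w def_c]].
      by rewrite def_c map_f // mem_enum -mem_trace -def_c.
    rewrite size_map -cardE size_filter; apply: leq_trans full_i.
    exact: card_le4 (E_nth lt_i).
  have in_e w : trace es w = trace es u -> w \in enum e.
    by move=> eq_w; rewrite mem_enum -mem_trace eq_w.
  have inj_e : {in enum e &, injective (trace es)}.
    move=> x y ex ey eq_xy; have : index x (enum e) = index y (enum e).
      apply: (uniqP [::] e_uniq); rewrite ?inE ?size_map ?index_mem //.
      by rewrite !(nth_map x) ?index_mem // !nth_index.
    by move/(congr1 (nth x (enum e))); rewrite !nth_index.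
  by apply: inj_e; rewrite ?in_e.
move=> _; apply: (@trace_meet_inj u v i j).
- by have := trace_uniq es u; rewrite def_u /= inE; case: eqVneq.
- by rewrite def_u mem_head.
- by rewrite def_u !inE eqxx orbT.
- by rewrite -eq_uv def_u mem_head.
- by rewrite -eq_uv def_u !inE eqxx orbT.
Qed.

End Search.

(* Relabellings that send the trace {0, 1, 2} of x to {0, 2, 3}, the trace of a
   point of the Fano plane lying on none of the lines 1, 4, 5, 6. *)
Definition perms6 :=
  [seq [:: 0; nth 0 u 0; 1; 2; nth 0 u 1; nth 0 u 2] | u <- permutations [:: 3; 4; 5]].

(* Relabellings that send {0, 1, 2} to {3, 5, 6} or one of its translates, that
   is, to the trace of an arbitrary point of the Fano plane. *)
Definition perms7 :=
  flatten [seq [seq rot k [:: nth 0 u 0; nth 0 u 1; nth 0 u 2; 0; nth 0 u 3; 1; 2]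
    | u <- permutations [:: 3; 4; 5; 6]] | k <- iota 0 7].

Definition targets7 :=
  [:: F1_codes; F2_codes 6; F3_codes 6 [:: [:: 3; 5]; [:: 0; 4]; [:: 1]; [:: 2]]].

(** The starting traces are those of x, w1, w2 and w3. With six edges their pencils exhaust the
    edges; with seven, label 6 is either an edge through none of them or the second edge through
    w3. *)
Lemma classified6 :
  classified 6 [:: [:: 0; 1; 2]; [:: 3]; [:: 4]; [:: 5]] perms6 [:: F1_minus_codes 6].
Proof. by vm_compute. Qed.

Lemma classified7_pendants :
  classified 7 [:: [:: 0; 1; 2]; [:: 3]; [:: 4]; [:: 5]] perms7 targets7.
Proof. by vm_compute. Qed.

Lemma classified7_pair :
  classified 7 [:: [:: 0; 1; 2]; [:: 3]; [:: 4]; [:: 5; 6]] perms7 targets7.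
Proof. by vm_compute. Qed.

(** * From the search to the isomorphism types *)

Section Classification.
Variables (V : finType) (E : {set {set V}}).
Hypotheses (linE : linear_hypergraph E) (intE : intersecting E).
Hypotheses (no_iso : no_isolated E) (card_le4 : forall e, e \in E -> #|e| <= 4).
Hypothesis undom : forall u v, exists w, ~~ adjacent E u w && ~~ adjacent E v w.

(** The search knows the traces only as a set, so two vertices of degree 1 might share a trace;
    [pendants_full] excludes this for the targets. A relabelling of the codes corresponds to
    permuting the enumeration of the edges. *)
Lemma classified_sound (es : seq {set V}) B0 perms targets :
  uniq es -> E =i es -> uniq B0 -> {subset B0 <= codom (trace es)} ->
  all (perm_eq (iota 0 (size es))) perms -> all pendants_full targets ->
  classified (size es) B0 perms targets ->
  exists2 T, T \in targets & has_codes E (size es) T.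
Proof.
move=> es_uniq eqE B0_uniq subB0 /allP perms_ok /allP full.
have [B [P [B_in P_in esT]]] :=
  search_sound linE intE no_iso card_le4 undom es_uniq eqE B0_uniq subB0.
move=> /allP/(_ B B_in)/allP/(_ P P_in) /=.
rewrite (undominated_codom eqE esT).2 //.
rewrite -has_find => /hasP[s perms_s /hasP[T T_in /andP[/allP subT /allP supT]]].
exists T => //; pose fs := [seq nth set0 es i | i <- s].
have eq_fs : perm_eq es fs.
  rewrite -{1}(mkseq_nth set0 es); exact/perm_map/perms_ok.
have eqF : E =i fs by move=> e; rewrite eqE (perm_mem eq_fs).
have fsT : codom (trace fs) =i T.
  move=> t; apply/codomP/idP=> [[v ->] | /supT/mapP[c]].
    by rewrite trace_relabel; apply/subT/map_f; rewrite -esT codom_f.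
  by rewrite -esT => /codomP[v ->] ->; exists v; rewrite trace_relabel.
exists fs; split; rewrite ?(perm_size eq_fs) //.
apply: (coded_pendants_full linE card_le4 _ eqF fsT); rewrite -?(perm_uniq eq_fs) //.
exact: full.
Qed.

Lemma trace_star_self v : trace (enum (star E v)) v = iota 0 (degree E v).
Proof. by rewrite trace_full -?cardE // => e; rewrite mem_enum inE => /andP[]. Qed.

Lemma trace_star_nonadjacent u v : ~~ adjacent E u v -> trace (enum (star E u)) v = [::].
Proof.
move=> nadj; apply: trace_nil => e; rewrite mem_enum inE => /andP[Ee ue].
exact: nonadjacent_edge nadj Ee ue.
Qed.

Lemma undominated_classification (v0 : V) :
  is_F1 E \/ is_F1_minus E \/ is_F2 E \/ is_F3 E.
Proof.
have [x deg_x] := exists_degree3 linE intE no_iso card_le4 undom v0.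
have [w1 [w2 [w3 [nadj deg1 deg2 deg3]]]] :=
  nonadjacent_triple_degrees linE intE no_iso card_le4 undom deg_x.
pose vs := [:: x; w1; w2; w3].
pose rest := [seq e <- enum E | e \notin pencils E vs].
(* With the pencils listed first, the labels 0, 1, 2 belong to x, 3 to w1, 4 to w2, and those from 5
   on to w3 and then to the remaining edges. *)
pose es := pencils E vs ++ rest.
have es_uniq : uniq es.
  rewrite cat_uniq uniq_pencils // filter_uniq ?enum_uniq // andbT.
  by apply/hasPn=> e; rewrite mem_filter => /andP[].
have eqE : E =i es.
  move=> e; rewrite mem_cat mem_filter mem_enum.
  by have [|_] := boolP (e \in pencils E vs); rewrite // mem_pencils => /andP[].
have size_es : size es = #|E|.
  by rewrite -(card_uniqP es_uniq); apply: eq_card => e; rewrite eqE.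
have trace_rest v : v \in vs -> trace rest v = [::].
  move=> vs_v; apply: trace_nil => e; rewrite mem_filter mem_enum => /andP[out Ee].
  by apply: contra out => ve; rewrite mem_pencils Ee; apply/hasP; exists v.
have esE : es = enum (star E x) ++ enum (star E w1) ++ enum (star E w2) ++
    enum (star E w3) ++ rest by rewrite /es /pencils /= cats0 -!catA.
have [/and4P[n1 n2 n3 _] /andP[/and3P[n12 n13 _] /andP[/andP[n23 _] _]]] := andP nadj.
have [m1 m2 m3] : [/\ ~~ adjacent E w1 x, ~~ adjacent E w2 x & ~~ adjacent E w3 x].
  by rewrite !(adjacentC _ _ x).
have [m12 m13 m23] :
    [/\ ~~ adjacent E w2 w1, ~~ adjacent E w3 w1 & ~~ adjacent E w3 w2].
  by rewrite !(adjacentC _ w3) (adjacentC _ w2).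
pose B0 := [:: [:: 0; 1; 2]; [:: 3]; [:: 4]; iota 5 (degree E w3)].
have subB0 : {subset B0 <= codom (trace es)}.
  have traces : [:: trace es x; trace es w1; trace es w2; trace es w3] = B0.
    rewrite esE !trace_cat !trace_rest ?inE ?eqxx ?orbT //.
    rewrite !trace_star_self !trace_star_nonadjacent // -!cardE.
    rewrite -!/(degree E _) deg_x deg1 deg2 /= ?cats0.
    by rewrite /B0; case: deg3 => -[-> _].
  by move=> t; rewrite -traces !inE => /or4P[] /eqP ->; exact: codom_f.
have B0_uniq : uniq B0 by rewrite /B0; case: deg3 => -[-> _].
have sound := classified_sound es_uniq eqE B0_uniq subB0.
rewrite size_es /B0 in sound.
have sound7 : #|E| = 7 -> classified 7 B0 perms7 targets7 ->
    is_F1 E \/ is_F1_minus E \/ is_F2 E \/ is_F3 E.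
  move=> card_E; rewrite card_E in sound => ok.
  have perms_ok : all (perm_eq (iota 0 7)) perms7 by vm_compute.
  have full : all pendants_full targets7 by vm_compute.
  have [T] := sound perms7 targets7 perms_ok full ok.
  rewrite !inE => /or3P[] /eqP -> E_codes.
  - by left; apply/is_F1P.
  - by right; right; left; apply: F2_codes_is_F2 E_codes.
  - by right; right; right; apply: F3_codes_is_F3.
case: deg3 => -[deg_w3 card_E]; last first.
  by apply: sound7; rewrite // /B0 deg_w3 classified7_pair.
case: card_E => card_E; last by apply: sound7; rewrite // /B0 deg_w3 classified7_pendants.
rewrite card_E deg_w3 in sound.
have perms_ok : all (perm_eq (iota 0 6)) perms6 by vm_compute.
have full : all pendants_full [:: F1_minus_codes 6] by vm_compute.
have [T] := sound _ _ perms_ok full classified6.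
rewrite !inE => /eqP -> E_codes; right; left.
exists (nth set0 fano_lines 6); first exact: fano_line_in_fano.
exact/(isomorphic_has_codes E (F1_minus_has_codes (isT : 6 < 7))).
Qed.

End Classification.

Theorem theorem3p2 (V : finType) (E : {set {set V}})
  (E_ge2 : edges_ge2 E) (E_linear : linear_hypergraph E)
  (E_intersecting : intersecting E) (E_rank : rank E = 4)
  (E_no_isolated : no_isolated E) :
  domination_number E = 3 <->
  is_F1 E \/ is_F1_minus E \/ is_F2 E \/ is_F3 E.
Proof.
split=> [dom3 | ]; last exact: F_domination.
have card_le4 e : e \in E -> #|e| <= 4.
  by move=> Ee; rewrite -E_rank; exact: (bigmax_sup e).
have undom u v : exists w, ~~ adjacent E u w && ~~ adjacent E v w.
  by apply: domination_undominated; rewrite dom3.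
have [v0 _ | V0] := pickP V; first exact: undominated_classification card_le4 undom v0.
(* Without vertices every set is empty, so the domination number is 0. *)
move: dom3; rewrite /domination_number; case: arg_minnP => [|D _ _].
  by apply/forallP=> v; have := V0 v.
by rewrite eq_card0 // => v; have := V0 v.
Qed.
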